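(* Let $V, W$ be real Banach spaces and let $h$ be a $C^1$ diffeomorphism of $V$ with $h^k = h \circ \cdots \circ h = \mathrm{id}_V$ ($k$-fold) for some integer $k \ge 1$. Let $f: [0,\infty) \times V \to V$ and $\Delta t > 0$ satisfy $$f(t, h^n(u)) = Dh^n(u)\, f(t + n\Delta t, u) \quad \text{for all } 1 \le n \le k,\ u \in V,\ t \ge 0.$$ Suppose there is $\Theta \in GL(V,W)$ and $\lambda < 0$ with $M^\Theta(f_t) \le \lambda$ for all $t \ge 0$. Then for every solution $u$ of $\dot u = f(t,u)$, the limit $p(t) = \lim_{n\to\infty} u(t + nk\Delta t)$ exists for every $t \ge 0$. The resulting function $p$ is $k\Delta t$-periodic, and $\|u(t) - p(t)\| \to 0$ exponentially as $t \to \infty$.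
   Context: For a real Banach space $X$, the right semi-inner product is $(a,b)_+ := \|a\| \lim_{s \to 0^+} \frac{\|a + sb\| - \|a\|}{s}$. For $\Theta \in GL(V,W)$ (a bijective bounded linear operator) and $g: V \to V$, $M^\Theta(g) := \sup_{u \ne v \in V} \frac{(\Theta(u-v), \Theta(g(u) - g(v)))_+}{\|\Theta(u-v)\|_W^2}$. We write $f_t = f(t,\cdot)$, and $D$ denotes the Fréchet derivative. Solutions are continuously differentiable curves $[0,\infty) \to V$ satisfying the equation for all $t \ge 0$. *)

(* Defs.v *)
From HB Require Import structures.
From mathcomp Require Import all_boot all_order all_algebra.
From mathcomp Require Import all_classical all_reals all_analysis.
Set Implicit Arguments. Unset Strict Implicit. Unset Printing Implicit Defensive.
Import Order.TTheory GRing.Theory Num.Theory.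
Import numFieldNormedType.Exports.
Local Open Scope classical_set_scope.
Local Open Scope ring_scope.

Definition semi_ip (R : realType) (W : normedModType R) (a b : W) : R :=
  `|a| * lim ((fun s : R => (`|a + s *: b| - `|a|) / s) @ 0^'+).

Definition MTheta (R : realType) (V W : normedModType R) (Theta : V -> W)
    (g : V -> V) : \bar R :=
  ereal_sup [set x | exists (u v : V), u <> v /\
     x = ((semi_ip (Theta (u - v)) (Theta (g u - g v))
           / `|Theta (u - v)| ^+ 2)%:E)].

Definition C1 (R : realType) (V W : normedModType R) (g : V -> W) : Prop :=
  (forall x, differentiable g x) /\
  (forall x (e : R), 0 < e -> exists2 d : R, 0 < d &
     forall y, `|y - x| < d -> forall w, `|'d g y w - 'd g x w| <= e * `|w|).

Definition C1_diffeo (R : realType) (V : normedModType R) (h : V -> V) : Prop :=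
  C1 h /\ exists g : V -> V, cancel h g /\ cancel g h /\ C1 g.

(* u : [0,oo) -> V is a (C^1) solution of u' = f(t,u) on [0,oo) *)
Definition is_solution (R : realType) (V : normedModType R)
    (f : R -> V -> V) (u : R -> V) : Prop :=
  (forall t : R, 0 < t -> is_derive t 1 u (f t (u t))) /\
  ((fun s : R => s^-1 *: (u s - u 0)) @ 0^'+ --> f 0 (u 0)) /\
  {within `[0, +oo[, continuous (fun t => f t (u t))}.

(* Main.v *)
(** Put [T = k dt]. Since [h^k = id], the symmetry with [n = k] says that [f] is
    [T]-periodic in time, so [u (. + T)] solves the same equation as [u].
    The bound on [M^Theta] makes the right derivative of
    [|Theta (u (t + T) - u t)|] at most [lambda] times itself wherever it does
    not vanish, so this norm stays below [K exp (lambda t / 2)] for any [K > 0]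
    dominating it at [t = 0]. The slack between [lambda] and [lambda / 2] makes
    the barrier strict, so zeros of the norm need no uniqueness theorem.
    By the open mapping theorem [|x| <= C |Theta x|]; hence the increments of
    [n |-> u (t + n T)] are geometrically small, the sequence converges, and its
    limit is within the sum of a geometric series of [u t]. *)
Require Import Defs.
From HB Require Import structures.
From mathcomp Require Import all_boot all_order all_algebra.
From mathcomp Require Import all_classical all_reals all_analysis.
From mathcomp Require Import ring lra.
Import Order.TTheory GRing.Theory Num.Theory.
Import numFieldNormedType.Exports.
Local Open Scope classical_set_scope.
Local Open Scope ring_scope.

(** * Geometric convergence and induction along the half-line *)

Lemma geometric_cvg (R : realType) (V : completeNormedModType R)
    (x : nat -> V) (C q : R) :
  0 <= q < 1 -> (forall n, `|x n.+1 - x n| <= C * q ^+ n) ->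
  exists2 l : V, x @ \oo --> l & `|l - x 0%N| <= C / (1 - q).
Proof.
move=> /andP[q0 q1] xC.
have C0 : 0 <= C by have := xC 0%N; rewrite expr0 mulr1; apply: le_trans.
have nq : `|q| < 1 by rewrite ger0_norm.
have gcvg := @cvg_geometric_series R C q nq.
(* Absolute convergence in a complete space, by comparison with the geometric series. *)
have scvg : cvgn (series (telescope x)).
  apply: normed_cvg; apply: (@series_le_cvg _ _ (geometric C q)).
  - by move=> n /=; exact: normr_ge0.
  - by move=> n; rewrite /geometric/= mulr_ge0 ?exprn_ge0.
  - by move=> n; exact: xC.
  - by apply/cvg_ex; exists (C / (1 - q)).
exists (x 0%N + lim (series (telescope x) @ \oo)).
  rewrite [X in X @ _](_ : x = (fun=> x 0%N) \+ series (telescope x)); last first.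
    by apply/funext => n /=; exact: eq_sum_telescope.
  by apply: cvgD; [exact: cvg_cst|exact: scvg].
rewrite addrAC subrr add0r.
have ncvg : `|series (telescope x) n| @[n --> \oo] --> `|limn (series (telescope x))| by exact: cvg_norm.
rewrite -(cvg_lim _ ncvg)//; apply: limr_le; first by apply/cvg_ex; eexists; exact: ncvg.
apply: nearW => n.
apply: (@le_trans _ _ (series (geometric C q) n)).
  by apply: le_trans (ler_norm_sum _ _ _) _; apply: ler_sum => i _; exact: xC.
rewrite -(cvg_lim _ gcvg)//; apply: nondecreasing_cvgn_le; last by apply/cvg_ex; eexists; exact: gcvg.
by apply: nondecreasing_series => i _ _; rewrite /geometric/= mulr_ge0 ?exprn_ge0.
Qed.

(** Consider the infimum of the failures of [P]. The closure hypothesis from the left makes [P] hold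
    there, and the hypothesis on the right then pushes all failures a fixed distance [e] beyond it,
    a contradiction. *)
Lemma continuous_induction (R : realType) (P : R -> Prop) :
  P 0 ->
  (forall a, 0 <= a -> P a -> \forall s \near 0^'+, P (a + s)) ->
  (forall a, 0 < a -> (forall s, 0 <= s < a -> P s) -> P a) ->
  forall t, 0 <= t -> P t.
Proof.
move=> P0 Pr Pl t t0; apply: contrapT => Pt.
pose S := [set s | 0 <= s /\ ~ P s].
have S0 : S !=set0 by exists t.
have lS : lbound S 0 by move=> s [].
have hS : has_inf S by split=> //; exists 0.
have a0 : 0 <= inf S by exact: lb_le_inf.
have PS s : 0 <= s < inf S -> P s.
  move=> /andP[s0 sa]; apply: contrapT => Ps.
  by move: sa; rewrite ltNge => /negP; apply; apply: ge_inf; [exists 0|].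
have Pa : P (inf S).
  by have [<-//|an0] := eqVneq 0 (inf S); apply: Pl => //; rewrite lt_neqAle an0.
have [e /= e0 Pe] := Pr _ a0 Pa.
have : inf S + e <= inf S.
  apply: lb_le_inf => // s [s0 Ps]; rewrite leNgt; apply/negP => sae.
  have : inf S <= s by apply: ge_inf; [exists 0|].
  rewrite le_eqVlt => /predU1P[as_|as_]; first by apply: Ps; rewrite -as_.
  apply: Ps; rewrite -(subrK (inf S) s) addrC; apply: Pe; last by rewrite subr_gt0.
  by rewrite /= sub0r normrN gtr0_norm ?subr_gt0// ltrBlDl.
by rewrite gerDl leNgt e0.
Qed.

(** * One-sided derivatives of a norm *)

(* The difference quotient is nondecreasing in [s] by convexity of the norm. *)
Lemma cvg_norm_right_quotient (R : realType) (W : normedModType R) (a b : W) :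
  cvg ((fun s : R => (`|a + s *: b| - `|a|) / s) @ 0^'+).
Proof.
apply: nondecreasing_at_right_is_cvgr.
  near=> x => s t; rewrite !in_itv/= => /andP[s0 _] /andP[t0 _] st.
  rewrite ler_pdivrMr// mulrAC ler_pdivlMr//.
  have -> : (`|a + s *: b| - `|a|) * t = `|t *: a + (s * t) *: b| - `|a| * t.
    rewrite mulrBl -[in X in _ * X - _](gtr0_norm t0) mulrC -normrZ scalerDr scalerA.
    by rewrite (mulrC t s).
  (* Divided by [t], this writes [a + s *: b] as a convex combination of [a] and [a + t *: b]. *)
  have -> : t *: a + (s * t) *: b = (t - s) *: a + s *: (a + t *: b).
    by rewrite scalerDr scalerA addrA -scalerDl subrK.
  rewrite lerBlDr (le_trans (ler_normD _ _))// !normrZ.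
  rewrite (gtr0_norm s0) ger0_norm ?subr_ge0//; lra.
near=> x; exists (- `|b|) => _ [s /= + <-]; rewrite in_itv/= => /andP[s0 _].
rewrite ler_pdivlMr// lerBrDr mulNr addrC lerBlDr.
have : `|a| <= `|a + s *: b| + `|s *: b|.
  by rewrite -[X in `|X| <= _](addrK (s *: b)) ler_normB.
by rewrite normrZ gtr0_norm// mulrC.
Unshelve. all: by end_near. Qed.

(** To first order [w (t + s)] is [w t + s *: b], so the norm grows at the rate [l] of the norm at
    [w t] in direction [b]. Half of the gap [m - l] absorbs the error of the difference quotient of
    the norm, the other half the remainder of [w]. *)
Lemma norm_right_growth (R : realType) (W : normedModType R) (w : R -> W)
    (t m : R) (b : W) :
  (fun s : R => s^-1 *: (w (t + s) - w t)) @ 0^'+ --> b ->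
  lim ((fun s : R => (`|w t + s *: b| - `|w t|) / s) @ 0^'+) < m ->
  \forall s \near 0^'+, `|w (t + s)| <= `|w t| + m * s.
Proof.
set l := lim _ => wb lm.
have e0 : 0 < (m - l) / 2 by rewrite divr_gt0// subr_gt0.
have lcvg : (fun s : R => (`|w t + s *: b| - `|w t|) / s) @ 0^'+ --> l.
  exact: cvg_norm_right_quotient.
near=> s.
have s0 : 0 < s by near: s; exact: nbhs_right_gt.
have H1 : `|l - (`|w t + s *: b| - `|w t|) / s| < (m - l) / 2.
  by near: s; by move/cvgrPdist_lt : lcvg; apply.
have H2 : `|b - s^-1 *: (w (t + s) - w t)| < (m - l) / 2.
  by near: s; by move/cvgrPdist_lt : wb; apply.
have K1 : `|w t + s *: b| <= `|w t| + (l + (m - l) / 2) * s.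
  move: H1; rewrite ltr_norml => /andP[H1 _].
  have : (`|w t + s *: b| - `|w t|) / s <= l + (m - l) / 2 by lra.
  by rewrite ler_pdivrMr// lerBlDl.
have K2 : `|w (t + s) - (w t + s *: b)| <= (m - l) / 2 * s.
  rewrite -[X in `|X|](_ : s *: (s^-1 *: (w (t + s) - w t) - b) = _).
    by rewrite normrZ gtr0_norm// mulrC distrC ler_wpM2r// ltW.
  by rewrite scalerBr scalerA divff ?gt_eqF// scale1r opprD addrA.
rewrite -[w (t + s)](subrK (w t + s *: b)) (le_trans (ler_normD _ _))//.
apply: le_trans (lerD K2 K1) _; lra.
Unshelve. all: by end_near. Qed.

(** * The open mapping theorem *)

Section open_mapping.
Variables (R : realType) (V W : completeNormedModType R) (L : {linear V -> W}).
Hypothesis surjL : forall w, exists v, L v = w.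

(* Baire: the closure of the image of some ball contains a ball. *)
Lemma surjective_linear_approx : exists2 M : R, 0 <= M &
  forall (w : W) (e : R), 0 < e -> exists2 v, `|v| <= M * `|w| & `|w - L v| < e.
Proof.
pose A (n : nat) := closure (L @` [set v | `|v| <= n%:R]).
(* Otherwise the complements are open and dense, and Baire yields a point with no preimage. *)
have [n nd] : exists n, ~ dense (~` A n).
  apply: contrapT => /forallNP dA.
  have : dense (\bigcap_n ~` A n).
    apply: Baire => n; split; last exact: contrapT (dA n).
    by apply: closed_openC; exact: closed_closure.
  move=> /(_ setT) []; [by exists point|exact: openT|].
  move=> w [_ Aw]; have [v Lv] := surjL w.
  apply: (Aw (Num.truncn `|v|).+1 I); apply: subset_closure; exists v => //=.
  exact/ltW/truncnS_gt.
have [U [[w0 /open_nbhs_nbhs /nbhs_ballP [r /= r0 bU]] UA]] := denseNE nd.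
have bA w : `|w| < r -> A n (w0 + w).
  move=> wr; apply: contrapT => nA.
  suff : (U `&` ~` A n) (w0 + w) by rewrite UA.
  split=> //; apply: bU; rewrite -ball_normE /ball_/= opprD addrA subrr sub0r.
  by rewrite normrN.
(* The ball found is centred at [w0], not at 0. Subtracting approximate preimages of [w0 + w] and
   [w0] recentres it, at the price of doubling the radius [n]. *)
have appr w e : 0 < e -> `|w| < r -> exists2 v, `|v| <= (n + n)%:R & `|w - L v| < e.
  move=> e0 wr.
  have e20 : 0 < e / 2 by rewrite divr_gt0.
  have ap z : A n z -> exists2 v, `|v| <= n%:R & `|z - L v| < e / 2.
    move=> /(_ _ (nbhsx_ballx _ _ e20)) [_ [[v vn <-]]].
    by rewrite -ball_normE => zv; exists v.
  have [v vn Hv] := ap _ (bA _ wr).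
  have [v' vn' Hv'] : exists2 v, `|v| <= n%:R & `|w0 - L v| < e / 2.
    by apply: ap; rewrite -[w0]addr0; apply: bA; rewrite normr0.
  exists (v - v'); first by rewrite natrD (le_trans (ler_normB _ _))// lerD.
  rewrite linearB/=.
  rewrite (_ : w - (L v - L v') = (w0 + w - L v) - (w0 - L v')); last first.
    rewrite !opprB (addrC w0) -!addrA; congr (_ + _).
    by rewrite (addrCA (- L v)) !(addrCA w0) subrr addr0.
  rewrite (le_lt_trans (ler_normB _ _))//; lra.
(* A nonzero [w] is rescaled to norm [r / 2], inside the ball; undoing this multiplies the bound
   [n + n] by [2 / r * |w|]. *)
exists ((n + n)%:R * (2 / r)).
  by rewrite mulr_ge0// divr_ge0// ltW.
move=> w e e0; have [->|w0'] := eqVneq w 0.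
  by exists 0; rewrite ?normr0 ?mulr0// linear0 subrr normr0.
have nw : 0 < `|w| by rewrite normr_gt0.
pose c := r / 2 / `|w|.
have c0 : 0 < c by rewrite !divr_gt0.
have [||v vn Hv] := appr (c *: w) (c * e).
- by rewrite mulr_gt0.
- rewrite normrZ gtr0_norm// /c divfK ?gt_eqF//; lra.
exists (c^-1 *: v).
  rewrite normrZ gtr0_norm ?invr_gt0// /c !invfM !invrK.
  rewrite (_ : _ * _ * `|v| = `|v| * (2 / r) * `|w|); last by ring.
  by rewrite ler_wpM2r// ler_wpM2r// divr_ge0// ltW.
rewrite linearZ/= -(ltr_pM2l c0) -[X in X * `|_|](gtr0_norm c0) -normrZ.
by rewrite scalerBr scalerA divff ?gt_eqF// scale1r.
Qed.

(** Successive approximation: each correction at least halves the norm of the residual, so the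
    corrections sum to an exact preimage, of norm at most [M * |w|] times the sum 2 of the powers of
    1/2. *)
Lemma surjective_linear_lift : continuous L ->
  exists2 C : R, 0 <= C & forall w, exists2 v, L v = w & `|v| <= C * `|w|.
Proof.
move=> cL; have [M M0 HM] := surjective_linear_approx.
have stepP (w : W) : exists v, `|v| <= M * `|w| /\ `|w - L v| <= `|w| / 2.
  have [->|w0] := eqVneq w 0.
    by exists 0; rewrite linear0 subrr !normr0 mulr0 mul0r.
  have [|v vM vL] := HM w (`|w| / 2); first by rewrite divr_gt0// normr_gt0.
  by exists v; split => //; exact: ltW.
have {stepP} [step stepP] := choice stepP.
exists (M * 2); first by rewrite mulr_ge0.
move=> w.
pose res n := iter n (fun z => z - L (step z)) w.
have resE n : `|res n| <= `|w| * 2^-1 ^+ n.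
  elim: n => [|n IH]; first by rewrite expr0 mulr1.
  rewrite exprSr mulrA; apply: le_trans (stepP _).2 _.
  by rewrite ler_wpM2r// invr_ge0.
pose x n := \sum_(i < n) step (res i).
have Lx n : L (x n) = w - res n.
  elim: n => [|n IH]; first by rewrite /x big_ord0 linear0 subrr.
  by rewrite /x big_ord_recr/= linearD/= IH opprB addrC addrCA.
have [||v xv] := @geometric_cvg R V x (M * `|w|) 2^-1.
- lra.
- move=> n; rewrite /x big_ord_recr/= addrAC subrr add0r -mulrA.
  by apply: le_trans (stepP _).1 _; rewrite ler_wpM2l.
rewrite /x big_ord0 subr0 => vM.
exists v; last first.
  apply: le_trans vM _; rewrite (_ : 1 - 2^-1 = 2^-1 :> R) ?invrK; first lra.
  by field.
have c1 : L (x n) @[n --> \oo] --> L v by apply: continuous_cvg => //; exact: cL.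
have res0 : res n @[n --> \oo] --> 0.
  apply: norm_cvg0; apply: (@squeeze_cvgr _ _ _ _ (cst 0) (fun n => `|w| * 2^-1 ^+ n)).
  - by apply: nearW => n; rewrite normr_ge0 resE.
  - exact: cvg_cst.
  - by apply: cvg_geometric; rewrite ger0_norm; lra.
have c2 : L (x n) @[n --> \oo] --> w.
  under eq_fun do rewrite Lx.
  have : (w - res n) @[n --> \oo] --> w - 0 by apply: cvgB => //; exact: cvg_cst.
  by rewrite subr0.
exact: cvg_unique c1 c2.
Qed.

End open_mapping.

(** * Contraction between solutions *)

Section dissipative.
Variables (R : realType) (V W : completeNormedModType R).
Variables (f : R -> V -> V) (L : {linear V -> W}).

(** The comparison argument sees only right derivatives. This form treats [t = 0] like any other
    time and passes to translates by a period of [f]. *)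
Definition right_solution (u : R -> V) : Prop :=
  (forall t, 0 <= t ->
    (fun s : R => s^-1 *: (u (t + s) - u t)) @ 0^'+ --> f t (u t)) /\
  (forall t, 0 < t -> {for t, continuous u}).

Lemma is_solution_right (u : R -> V) : is_solution f u -> right_solution u.
Proof.
move=> [du [du0 _]]; split=> t; last first.
  move=> /du [dut _]; apply: differentiable_continuous.
  exact/derivable1_diffP.
rewrite le_eqVlt => /predU1P[<-|t0].
  by under eq_fun do rewrite add0r.
have [dut <-] := du _ t0.
rewrite (_ : (fun s => _) =
    fun s : R => s^-1 *: ((u \o shift t) (s *: (1 : R)) - u t)); last first.
  by apply/funext => s; rewrite /= -[s *: 1]/(s * 1) mulr1 (addrC s).
by apply: cvg_dnbhs_at_right; exact: dut.
Qed.

Lemma MTheta_growth (g : V -> V) (lambda : R) (x y : V) :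
  injective L -> (MTheta L g <= lambda%:E)%E -> x <> y ->
  lim ((fun s : R => (`|L (x - y) + s *: L (g x - g y)| - `|L (x - y)|) / s)
    @ 0^'+) <= lambda * `|L (x - y)|.
Proof.
move=> injL Ml xy.
have Lxy : 0 < `|L (x - y)|.
  rewrite normr_gt0; apply/eqP => L0; apply: xy; apply/eqP.
  by rewrite -subr_eq0; apply/eqP/injL; rewrite L0 linear0.
have : ((semi_ip (L (x - y)) (L (g x - g y)) / `|L (x - y)| ^+ 2)%:E
    <= lambda%:E)%E.
  by apply: le_trans Ml; apply: ereal_sup_ubound; exists x, y.
rewrite lee_fin /semi_ip ler_pdivrMr ?exprn_gt0// expr2 mulrC mulrA.
by rewrite ler_pM2r.
Qed.

Lemma solutions_contract (lambda K : R) (u v : R -> V) :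
  continuous L -> injective L -> lambda < 0 ->
  (forall t, 0 <= t -> (MTheta L (f t) <= lambda%:E)%E) ->
  right_solution u -> right_solution v ->
  0 < K -> `|L (u 0 - v 0)| <= K ->
  forall t, 0 <= t -> `|L (u t - v t)| <= K * expR (lambda / 2 * t).
Proof.
move=> cL injL l0 Ml [du cu] [dv cv] K0 uvK.
pose w t := L (u t - v t).
have dw t : 0 <= t -> (fun s : R => s^-1 *: (w (t + s) - w t)) @ 0^'+ -->
    L (f t (u t) - f t (v t)).
  move=> t0.
  rewrite (_ : (fun s => _) = L \o ((fun s : R => s^-1 *: (u (t + s) - u t)) \-
                         (fun s : R => s^-1 *: (v (t + s) - v t)))).
    by apply: continuous_cvg; [exact: cL|apply: cvgB; [exact: du|exact: dv]].
  apply/funext => s /=; rewrite -scalerBr linearZ/= /w -linearB/=.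
  by congr (_ *: L _); rewrite !opprB addrACA [RHS]addrACA
     [- u t + _]addrC.
have cw t : 0 < t -> {for t, continuous (fun t => `|w t|)}.
  move=> t0; apply: (@continuous_comp _ _ _ w Num.norm); last exact: norm_continuous.
  apply: continuous_comp; last exact: cL.
  by apply: continuousB; [exact: cu|exact: cv].
pose E t := K * expR (lambda / 2 * t).
have E0 t : 0 < E t by rewrite mulr_gt0// expR_gt0.
(* The convex barrier lies above its tangent lines, by [1 + x <= expR x]. *)
have EDge t s : E t + lambda / 2 * E t * s <= E (t + s).
  rewrite /E mulrDr expRD.
  have -> : K * expR (lambda / 2 * t) + lambda / 2 * (K * expR (lambda / 2 * t)) * s =
     K * expR (lambda / 2 * t) * (1 + lambda / 2 * s) by ring.
  by rewrite [leRHS]mulrA ler_wpM2l ?expR_ge1Dx// ltW//; exact: E0.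
have cE t : {for t, continuous E}.
  apply: continuousM; first exact: cvg_cst.
  apply: continuous_comp; last exact: continuous_expR.
  by apply: continuousM; [exact: cvg_cst|exact: cvg_id].
apply: continuous_induction.
- by rewrite mulr0 expR0 mulr1.
- move=> a a0; rewrite -/(w a) -/(E a) le_eqVlt => /predU1P[waE|waE].
    (* At a touching point [u a <> v a], and the slope of [|w|] is at most
       [lambda * E a], strictly below that of the barrier [E]. *)
    have uva : u a <> v a.
      move=> uv; have := E0 a.
      by rewrite -waE /w uv subrr linear0 normr0 ltxx.
    have lim_lt : lim ((fun s : R => (`|w a + s *: L (f a (u a) - f a (v a))|
        - `|w a|) / s) @ 0^'+) < lambda / 2 * E a.
      apply: le_lt_trans (MTheta_growth _ _ _ _ injL (Ml _ a0) uva) _.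
      by rewrite -/(w a) waE ltr_pM2r//; lra.
    apply: filterS (norm_right_growth _ _ _ _ _ _ (dw _ a0) lim_lt) => s ws.
    by apply: le_trans ws _; rewrite waE; exact: EDge.
  (* Strictly below the barrier any finite slope bound will do. [B] is the excess of the slope
     [|l| + 1] over that of the tangent to [E], so the gap [E a - |w a|] survives while [s] is less
     than the gap divided by [B]. *)
  set l := lim ((fun s : R => (`|w a + s *: L (f a (u a) - f a (v a))|
        - `|w a|) / s) @ 0^'+).
  have lm : l < `|l| + 1 by rewrite (le_lt_trans (ler_norm _))// ltrDl.
  have gr := norm_right_growth _ _ _ _ _ _ (dw _ a0) lm.
  pose B := `|l| + 1 - lambda / 2 * E a.
  have B0 : 0 < B.
    have : 0 < - lambda / 2 * E a by rewrite mulr_gt0//; lra.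
    by have := normr_ge0 l; rewrite /B; lra.
  near=> s.
  have s0 : 0 < s by near: s; exact: nbhs_right_gt.
  have sB : s < (E a - `|w a|) / B.
    by near: s; apply: nbhs_right_lt; rewrite divr_gt0// subr_gt0.
  have ws : `|w (a + s)| <= `|w a| + (`|l| + 1) * s by near: s; exact: gr.
  apply: le_trans ws _; apply: le_trans (EDge a s).
  move: sB; rewrite ltr_pdivlMr// /B; lra.
(* The non-strict inequality passes to left limits by continuity. *)
- move=> a a0 Ha.
  have w_left : (fun t => `|w t|) @ a^'- --> `|w a|.
    by apply: cvg_at_left_filter; exact: cw.
  have E_left : E @ a^'- --> E a by apply: cvg_at_left_filter; exact: cE.
  rewrite -/(w a) -/(E a) -(cvg_lim _ w_left)// -(cvg_lim _ E_left)//.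
  apply: ler_lim.
  + by apply/cvg_ex; eexists; exact: w_left.
  + by apply/cvg_ex; eexists; exact: E_left.
  near=> s; apply: Ha; apply/andP; split; last by near: s; exact: nbhs_left_lt.
  by apply/ltW; near: s; exact: nbhs_left_gt.
Unshelve. all: by end_near. Qed.

End dissipative.

(** * Convergence to a periodic function *)

Theorem mainTheorem13 (R : realType) (V W : completeNormedModType R)
  (h : V -> V) (k : nat) (f : R -> V -> V) (dt : R)
  (Theta : {linear V -> W}) (lambda : R) :
  C1_diffeo h ->
  (1 <= k)%N ->
  iter k h = id ->
  0 < dt ->
  (forall (n : nat) (u : V) (t : R), (1 <= n <= k)%N -> 0 <= t ->
     f t (iter n h u) = 'd (iter n h) u (f (t + n%:R * dt) u)) ->
  continuous Theta -> bijective Theta ->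
  lambda < 0 ->
  (forall t : R, 0 <= t -> (MTheta Theta (f t) <= lambda%:E)%E) ->
  forall u : R -> V, is_solution f u ->
  exists p : R -> V,
    (forall t : R, 0 <= t ->
       (fun n : nat => u (t + n%:R * k%:R * dt)) @ \oo --> p t) /\
    (forall t : R, 0 <= t -> p (t + k%:R * dt) = p t) /\
    (exists C c : R, 0 < c /\
       forall t : R, 0 <= t -> `|u t - p t| <= C * expR (- (c * t))).
Proof.
move=> _ k1 hk dt0 fh cL bijL l0 Ml u /is_solution_right uS.
have injL := bij_inj bijL.
have [C C0 HC] : exists2 C : R, 0 <= C & forall x, `|x| <= C * `|Theta x|.
  have surjL w : exists v, Theta v = w.
    by case: bijL => g _ gK; exists (g w); rewrite gK.
  have [C C0 HC] := @surjective_linear_lift R V W Theta surjL cL.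
  by exists C => // x; have [v /injL <-] := HC (Theta x).
pose T := k%:R * dt.
have T0 : 0 < T by rewrite mulr_gt0// ltr0n.
have fT t x : 0 <= t -> f (t + T) x = f t x.
  move=> t0; have := fh k x t; rewrite k1 leqnn hk => /(_ erefl t0) ->.
  by have [_ ->] := is_diff_id x.
have [du cu] := uS.
have vS : right_solution R V f (fun t => u (t + T)).
  split=> t t0.
    rewrite -fT//; under eq_fun do rewrite addrAC.
    by apply: du; rewrite addr_ge0// ltW.
  apply: (@continuous_comp _ _ _ (fun t => t + T) u).
    by apply: continuousD; [exact: cvg_id|exact: cvg_cst].
  by apply: cu; rewrite addr_gt0.
(* The added 1 keeps the barrier positive even if [u T = u 0]. *)
pose K := `|Theta (u (0 + T) - u 0)| + 1.
have K0 : 0 < K by rewrite ltr_wpDl.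
have dec := solutions_contract _ _ _ _ _ _ K _ _ cL injL l0 Ml vS uS K0 _.
have {dec} uT t : 0 <= t -> `|u (t + T) - u t| <= C * K * expR (- (- lambda / 2 * t)).
  move=> t0; apply: le_trans (HC _) _; rewrite -mulrA ler_wpM2l//.
  rewrite (_ : - (- lambda / 2 * t) = lambda / 2 * t); last by lra.
  by apply: dec => //; rewrite lerDl.
pose c := - lambda / 2.
have c0 : 0 < c by rewrite /c; lra.
pose q := expR (- (c * T)).
have q1 : q < 1 by rewrite expR_lt1 oppr_lt0 mulr_gt0.
(* The condition [0 <= t] stands under the existential so that choice gives a total [p]; negative
   times get the value 0. *)
have ex_lim t : exists l, 0 <= t ->
    (fun n : nat => u (t + n%:R * k%:R * dt)) @ \oo --> l /\
    `|u t - l| <= C * K / (1 - q) * expR (- (c * t)).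
  have [t0|] := boolP (0 <= t); last by exists 0.
  (* Keeping the factor [expR (- (c * t))] in the constant, with [q] the decay over one period,
     turns the bound on the limit into the exponential estimate. *)
  have [||l ul lu] := @geometric_cvg R V (fun n => u (t + n%:R * k%:R * dt))
      (C * K * expR (- (c * t))) q.
  - by rewrite expR_ge0.
  - move=> n.
    rewrite (_ : t + n.+1%:R * k%:R * dt = t + n%:R * k%:R * dt + T); last first.
      by rewrite /T -natr1; ring.
    apply: le_trans (uT _ _) _.
      by rewrite addr_ge0// !mulr_ge0// ltW.
    rewrite -/c -[leRHS]mulrA (_ : expR (- (c * t)) * q ^+ n =
      expR (- (c * (t + n%:R * k%:R * dt))))//.
    by rewrite /q -expRM_natl -expRD /T; congr expR; ring.
  exists l => _; split => //.
  move: lu; rewrite !mul0r addr0 distrC => /le_trans; apply.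
  by rewrite mulrAC.
have [p pP] := choice ex_lim.
exists p; split; first by move=> t /pP[].
split.
  move=> t t0; have tT : 0 <= t + k%:R * dt by rewrite addr_ge0// ltW.
  have [ut _] := pP _ t0; have [utT _] := pP _ tT.
  apply: (cvg_unique _ utT) => //.
  (* The sequence sampled from [t + T] is the one sampled from [t] with its first term dropped. *)
  move: ut; rewrite -cvg_shiftS; apply: cvg_trans; apply: near_eq_cvg; apply: nearW => n /=.
  by congr (u _); rewrite -natr1; ring.
exists (C * K / (1 - q)), c; split => // t t0.
by have [] := pP _ t0.
Qed.
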